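(* Let $n \ge 3$ be an integer. 1. If $n \equiv 3 \pmod 4$, then an $E(n,(n+1)/2,n+1)$ exists if and only if a Hadamard matrix of order $n+1$ exists. 2. If $n \equiv 0 \pmod 4$, then an $E(n,n/2,n)$ exists if and only if a Hadamard matrix of order $n$ exists. 3. If $n \equiv 1 \pmod 4$, then an $E(n,(n-1)/2,n)$ exists if and only if there is a positive integer $u$ such that $n = 2u^2+2u+1$ and a $\left(2u^2+2u+1,\ u^2,\ (u^2-u)/2\right)$-SBIBD exists. 4. If $n \equiv 2 \pmod 4$, then an $E(n,(n-2)/2,n)$ exists if and only if there is a positive integer $u$ such that at least one of the following holds: (a) $n = 12u^2+8u+2$ and a $\left(12u^2+8u+2,\ 6u^2+u,\ 3u^2-u\right)$-SBIBD exists; or (b) $n = 12u^2-8u+2$ and a $\left(12u^2-8u+2,\ 6u^2-7u+2,\ 3u^2-5u+2\right)$-SBIBD exists.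
   Context: An equidistant code $E(n,d,m)$ is a set of $m$ distinct binary codewords of length $n$ (elements of $\{0,1\}^n$) such that the Hamming distance between any two distinct codewords is exactly $d$. A Hadamard matrix of order $N$ is an $N \times N$ matrix $H$ with entries in $\{1,-1\}$ such that $HH^{T} = N I_N$. A $(v,k,\lambda)$-SBIBD (symmetric balanced incomplete block design) consists of a set of $v$ points and a collection of $v$ blocks (subsets of the point set), each of size $k$, such that every point lies in exactly $k$ blocks and every pair of distinct points lies in exactly $\lambda$ blocks. Trivial designs, such as those with $k=1$, $\lambda=0$, are allowed. *)

(* Defs.v *)
From mathcomp Require Import all_boot all_order all_algebra.

Set Implicit Arguments.
Unset Strict Implicit.
Unset Printing Implicit Defensive.

Import GRing.Theory.

Definition hamming (n : nat) (x y : n.-tuple bool) : nat :=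
  #|[set i : 'I_n | tnth x i != tnth y i]|.

Definition equidistant_code (n d m : nat) (C : {set n.-tuple bool}) : Prop :=
  #|C| = m /\ (forall x y, x \in C -> y \in C -> x <> y -> hamming x y = d).

Definition hadamard (N : nat) (H : 'M[int]_N) : Prop :=
  (forall i j, H i j = 1%R \/ H i j = (-1)%R) /\
  (H *m H^T = (N%:Z)%:M)%R.

(* The blocks form a family indexed by 'I_v, so repeated blocks are not
   excluded a priori. *)
Definition sbibd (v k lambda : nat) (B : 'I_v -> {set 'I_v}) : Prop :=
  [/\ forall b : 'I_v, #|B b| = k,
      forall p : 'I_v, #|[set b | p \in B b]| = k
    & forall p q : 'I_v, p <> q ->
        #|[set b | (p \in B b) && (q \in B b)]| = lambda].

Definition code_exists (n d m : nat) : Prop :=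
  exists C : {set n.-tuple bool}, equidistant_code d m C.

Definition hadamard_exists (N : nat) : Prop :=
  exists H : 'M[int]_N, hadamard H.

Definition sbibd_exists (v k lambda : nat) : Prop :=
  exists B : 'I_v -> {set 'I_v}, sbibd k lambda B.

(* Main.v *)
Require Import Defs.
From mathcomp Require Import all_boot all_order all_algebra.
From mathcomp Require Import zify ring lra.

Import GRing.Theory Num.Theory.

(** Write the codewords as the rows of a matrix M of signs: two rows of length
    n at distance d have inner product n - 2d, so an equidistant code is a sign
    matrix whose Gram matrix M M^T is constant off the diagonal.

    If d = n/2 and there are n words, this constant is 0 and M is a Hadamard
    matrix.  If d = (n+1)/2 and there are n+1 words of length n, the constant
    is -1, which a column of ones turns into 0; conversely a Hadamard matrix
    whose rows are normalized to start with 1 can be punctured at its first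
    column ([code_hadamard], [code_hadamard_punctured]).

    In the two other cases there are n words and b = n - 2d is 1 or 2, so that
    M M^T = 2d I + b J.  Such a matrix is invertible with an explicit inverse,
    and commuting M with its inverse gives c M^T M = 2dc I + b s s^T, where
    c = 2d + bn and s is the vector of column sums ([gram_transpose]).  The
    diagonal entries of M^T M are all n, so every column sum squares to c.
    Negating columns preserves the distances between the rows, so all column
    sums may be taken equal to the same root of c; then all row sums are equal
    to it too ([square_equidistant_regular]), and the minus signs of M form an
    SBIBD ([square_equidistant_sbibd]).  Conversely the rows of the incidence
    matrix of an SBIBD are equidistant ([sbibd_equidistant_code]).

    What remains is arithmetic: c = 2n - 1 is a square (2u+1)^2 when b = 1, and
    c = 3n - 2 is a square (2t)^2 when b = 2; in the latter case 3 does not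
    divide t, and the two residues t = 3u+1 and t = 3u-1 are the two families
    of designs. *)

(** * Codes as families of rows *)

Definition equidistant_rows {m n : nat} (d : nat) (W : 'I_m -> 'I_n -> bool) :=
  forall i j, i != j -> \sum_k (W i k (+) W j k) = d.

Lemma card_sum_bool (n : nat) (a : 'I_n -> bool) :
  #|[set i | a i]| = \sum_i a i.
Proof. by rewrite -sum1dep_card big_mkcond; apply: eq_bigr => i _; case: (a i). Qed.

Lemma sum_negb (n : nat) (a : 'I_n -> bool) :
  \sum_i a i + \sum_i ~~ a i = n.
Proof.
rewrite -big_split /= -[RHS]card_ord -sum1_card.
by apply: eq_bigr => i _; case: (a i).
Qed.

Lemma hamming_sum (n : nat) (x y : n.-tuple bool) :
  hamming x y = \sum_k (tnth x k (+) tnth y k).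
Proof.
rewrite /hamming card_sum_bool; apply: eq_bigr => k _.
by case: (tnth x k) (tnth y k) => [] [].
Qed.

(** A code is a set of words, while matrices need indexed rows.  Positivity of
    the distance makes the rows of the family distinct. *)
Lemma code_exists_rows (m n d : nat) : 0 < d ->
  code_exists n d m <->
  exists W : 'I_m -> 'I_n -> bool, equidistant_rows d W.
Proof.
move=> d_gt0; split=> [[C [cardC distC]]|[W distW]].
  subst m; exists (fun i k => tnth (enum_val i) k) => i j ij.
  rewrite -hamming_sum distC ?enum_valP// => /enum_val_inj eij.
  by rewrite eij eqxx in ij.
pose x i := [tuple W i k | k < n].
have distx i j : i != j -> hamming (x i) (x j) = d.
  move=> /distW <-; rewrite hamming_sum.
  by apply: eq_bigr => k _; rewrite !tnth_mktuple.
have x_inj : injective x.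
  move=> i j eij; apply/eqP/negPn/negP => /distx.
  rewrite eij hamming_sum big1 => [d0|k _]; first by rewrite -d0 in d_gt0.
  by rewrite addbb.
exists [set x i | i : 'I_m]; split; first by rewrite card_imset// card_ord.
move=> _ _ /imsetP[i _ ->] /imsetP[j _ ->] xij; apply: distx.
by apply/eqP => eij; apply: xij; rewrite eij.
Qed.

(** * Sign matrices and Hadamard matrices *)

Definition sign_matrix {R : pzRingType} {m n : nat}
  (W : 'I_m -> 'I_n -> bool) : 'M[R]_(m, n) :=
  (\matrix_(i, j) (-1) ^+ W i j)%R.

Lemma sum_sign (R : pzRingType) (n : nat) (a : 'I_n -> bool) :
  (\sum_k (-1) ^+ a k = n%:R - (2 * \sum_k a k)%:R :> R)%R.
Proof.
rewrite natrM natr_sum mulr_sumr -[X in _ = (X%:R - _)%R](card_ord n).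
rewrite -sumr_const -sumrB; apply: eq_bigr => k _.
by rewrite signrE -natrM mul2n.
Qed.

Lemma sign_gramE (R : pzRingType) (m n : nat) (W : 'I_m -> 'I_n -> bool) i j :
  ((sign_matrix W *m (sign_matrix W)^T) i j
   = n%:R - (2 * \sum_k (W i k (+) W j k))%:R :> R)%R.
Proof.
rewrite mxE -sum_sign; apply: eq_bigr => k _.
by rewrite !mxE signr_addb.
Qed.

Lemma hadamard_exists_rows (N : nat) :
  hadamard_exists N <->
  exists W : 'I_N -> 'I_N -> bool,
    forall i j, i != j -> 2 * \sum_k (W i k (+) W j k) = N.
Proof.
split=> [[H [entries gram]]|[W distW]].
  pose W i j := H i j == (-1)%R.
  have HW : H = sign_matrix W.
    by apply/matrixP => i j; rewrite mxE /W; case: (entries i j) => ->.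
  exists W => i j ij; have /eqP := sign_gramE int _ _ W i j.
  rewrite -HW gram mxE (negPf ij) mulr0n eq_sym subr_eq0.
  by move=> /eqP e; lia.
exists (sign_matrix W); split=> [i j|].
  by rewrite mxE; case: (W i j); [right|left].
apply/matrixP => i j; rewrite sign_gramE mxE.
have [<-|/distW ->] := eqVneq i j; last by rewrite subrr mulr0n.
by rewrite big1 ?subr0 ?natz// => k _; rewrite addbb.
Qed.

Lemma code_hadamard (N d : nat) : 0 < d -> 2 * d = N ->
  code_exists N d N <-> hadamard_exists N.
Proof.
move=> d_gt0 dN; rewrite (code_exists_rows N N d d_gt0) hadamard_exists_rows.
by split=> -[W distW]; exists W => i j /distW; lia.
Qed.

(** The column added to a code is constant, hence changes no distance.  In the
    other direction, adding the first entry of each row to the whole row makes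
    the first column zero; a row distance D = (n+1)/2 either is unchanged or
    becomes n + 1 - D, which is the same number. *)
Lemma code_hadamard_punctured (n d : nat) : 0 < d -> 2 * d = n.+1 ->
  code_exists n d n.+1 <-> hadamard_exists n.+1.
Proof.
move=> d_gt0 dn; rewrite (code_exists_rows _ _ _ d_gt0) hadamard_exists_rows.
split=> -[W distW].
  exists (fun i k => oapp (W i) false (unlift ord0 k)) => i j /distW distij.
  transitivity (2 * d) => //; congr (2 * _).
  rewrite -distij big_ord_recl unlift_none /= add0n.
  by apply: eq_bigr => k _; rewrite liftK.
exists (fun i k => W i ord0 (+) W i (lift ord0 k)) => i j /distW.
rewrite big_ord_recl.
under [in X in _ -> X]eq_bigr => k _ do rewrite addbACA.
have := sum_negb n (fun k => W i (lift ord0 k) (+) W j (lift ord0 k)).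
by case: (W i ord0 (+) W j ord0) => /=; lia.
Qed.

(** * Regularity of square equidistant families *)

Section RegularSquares.
Local Open Scope ring_scope.

(** The matrices a I + b u u^T and c I - b u u^T have product ac I as soon as
    c = a + b u^T u; hence M^T (c I - b u u^T) is, up to the factor ac, a
    right inverse of M.  A right inverse of a square matrix is a left inverse,
    which is the identity below. *)
Lemma gram_transpose (F : fieldType) (n : nat) (M : 'M[F]_n) (u : 'cV[F]_n)
    (a b c : F) :
  M *m M^T = a%:M + b *: (u *m u^T) -> c%:M = a%:M + b *: (u^T *m u) ->
  a != 0 -> c != 0 ->
  c *: (M^T *m M) = (a * c)%:M + b *: ((M^T *m u) *m (M^T *m u)^T).
Proof.
move=> gram cE a0 c0.
pose Z := M^T *m (c%:M - b *: (u *m u^T)).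
have PP : b *: (u *m u^T *m (u *m u^T)) = (c - a) *: (u *m u^T).
  have bE : b *: (u^T *m u) = (c - a)%:M by rewrite raddfB /= cE addrC addKr.
  rewrite -mulmxA [u^T *m (_ *m _)]mulmxA [LHS]scalemxAr [b *: _]scalemxAl bE.
  by rewrite mul_scalar_mx -scalemxAr.
have MZ : M *m Z = (a * c)%:M.
  rewrite /Z mulmxA gram mulmxDl !mulmxBr -scalar_mxM mul_scalar_mx.
  rewrite -!scalemxAr -!scalemxAl PP mul_mx_scalar !scalerA -addrA.
  rewrite -scalerBl -scaleNr -scalerDl.
  by rewrite (_ : - (a * b) + _ = 0) ?scale0r ?addr0//; ring.
have : Z *m M = (a * c)%:M.
  have ac0 : a * c != 0 by rewrite mulf_neq0.
  have : ((a * c)^-1 *: Z) *m M = 1%:M.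
    apply: mulmx1C; rewrite -scalemxAr MZ.
    by rewrite scale_scalar_mx mulVf.
  rewrite -scalemxAl => /(congr1 (GRing.scale (a * c))).
  by rewrite scalerA mulfV// scale1r scalemx1.
rewrite /Z => <-.
rewrite trmx_mul trmxK mulmxBr mulmxBl mul_mx_scalar -scalemxAl.
by rewrite -scalemxAr -scalemxAl !mulmxA subrK.
Qed.

Lemma equidistant_gram (R : comPzRingType) (n d : nat) (W : 'I_n -> 'I_n -> bool) :
  equidistant_rows d W ->
  let M := sign_matrix W in let u := const_mx 1 : 'cV[R]_n in
  M *m M^T = (2 * d)%:R%:M + (n%:R - (2 * d)%:R) *: (u *m u^T).
Proof.
move=> distW M u; apply/matrixP => i j; rewrite sign_gramE !mxE big_ord1 !mxE.
rewrite !mulr1; have [<-|/distW ->] := eqVneq i j.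
  rewrite big1 => [|k _]; last by rewrite addbb.
  by rewrite muln0 subr0 mulr1n addrC subrK.
by rewrite mulr0n add0r.
Qed.

(** All column sums of the sign matrix square to c = 2d + (n-2d)n by comparing
    diagonals in [gram_transpose]; the sign hypothesis on them selects the
    common root s.  Then M^T 1 = s 1, and s (M 1) = M M^T 1 = c 1 = s^2 1 gives
    the row sums. *)
Lemma square_equidistant_regular (n d : nat) (W : 'I_n -> 'I_n -> bool) :
  (0 < d)%N -> (2 * d < n)%N -> equidistant_rows d W ->
  (forall j, 2 * \sum_i W i j <= n)%N ->
  exists2 s : nat, (s ^ 2 = 2 * d + (n - 2 * d) * n)%N &
    (forall j, 2 * \sum_i W i j + s = n)%N /\
    (forall i, 2 * \sum_j W i j + s = n)%N.
Proof.
move=> d_gt0 dn distW col_le.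
have n_gt0 : (0 < n)%N by lia.
pose M : 'M[rat]_n := sign_matrix W; pose u : 'cV[rat]_n := const_mx 1.
have gram : M *m M^T = _ := equidistant_gram _ _ _ _ distW.
set a := (2 * d)%:R in gram; set b := _ - a in gram.
pose c : rat := a + b * n%:R.
have a_gt0 : 0 < a by rewrite ltr0n; lia.
have b_gt0 : 0 < b by rewrite subr_gt0 ltr_nat.
have c_gt0 : 0 < c by rewrite addr_gt0// mulr_gt0// ltr0n.
have uu : u^T *m u = n%:R%:M.
  apply/matrixP => i j; rewrite !ord1 !mxE eqxx mulr1n.
  under eq_bigr => k _ do rewrite !mxE mulr1.
  by rewrite sumr_const card_ord.
have colE j : (M^T *m u) j 0 = n%:R - (2 * \sum_i W i j)%:R.
  rewrite mxE -sum_sign; apply: eq_bigr => i _.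
  by rewrite !mxE mulr1.
have rowE i : (M *m u) i 0 = n%:R - (2 * \sum_j W i j)%:R.
  rewrite mxE -sum_sign; apply: eq_bigr => j _.
  by rewrite !mxE mulr1.
have cE : c%:M = a%:M + b *: (u^T *m u).
  by rewrite uu scale_scalar_mx -raddfD.
have cogram := gram_transpose _ _ _ _ _ _ _ gram cE (lt0r_neq0 a_gt0)
  (lt0r_neq0 c_gt0).
have col_sqr j : (M^T *m u) j 0 ^+ 2 = c.
  have /matrixP/(_ j j) := cogram.
  (* Only the entries of the outer operations are unfolded, so that the column
     sum (M^T u) j 0 stays folded. *)
  rewrite mxE [X in _ * X]mxE [RHS]mxE [X in _ = X + _]mxE eqxx mulr1n.
  rewrite [X in _ = _ + X]mxE [X in b * X]mxE big_ord1 [X in _ * (_ * X)]mxE.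
  rewrite (eq_bigr (fun=> 1)) => [|k _]; last by rewrite !mxE -expr2 sqrr_sign.
  rewrite sumr_const card_ord => e; apply: (mulfI (lt0r_neq0 b_gt0)).
  by rewrite expr2; move: e; rewrite /b => e; lra.
have cN : c = (2 * d + (n - 2 * d) * n)%:R.
  by rewrite /c /b /a natrD (natrM _ (n - _)) natrB// ltnW.
pose t := (n - 2 * \sum_i W i (Ordinal n_gt0))%N.
have tE : t%:R = (M^T *m u) (Ordinal n_gt0) 0 by rewrite colE natrB.
have t_gt0 : 0 < t%:R :> rat.
  rewrite lt0r ler0n andbT; apply/eqP => t0.
  by have := col_sqr (Ordinal n_gt0); rewrite -tE t0; move: c_gt0; lra.
have colt j : (M^T *m u) j 0 = t%:R.
  apply/eqP; rewrite -(@eqrXn2 _ 2) ?ler0n//; last by rewrite colE subr_ge0 ler_nat.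
  by rewrite col_sqr tE col_sqr.
have MMu : M *m (M^T *m u) = c *: u.
  rewrite mulmxA gram mulmxDl mul_scalar_mx -scalemxAl -mulmxA uu mul_mx_scalar.
  by rewrite scalerA -scalerDl.
have rowt i : (M *m u) i 0 = t%:R.
  have colu : M^T *m u = t%:R *: u.
    by apply/colP => j; rewrite colt !mxE mulr1.
  apply: (mulfI (lt0r_neq0 t_gt0)).
  have /colP/(_ i) := MMu; rewrite colu -scalemxAr mxE => ->.
  by rewrite !mxE mulr1 -expr2 tE col_sqr.
exists t.
  by apply/eqP; rewrite -(eqr_nat rat) -cN natrX tE col_sqr.
split=> j; apply/eqP; rewrite -(eqr_nat rat) natrD.
  by rewrite -(colt j) colE addrC subrK.
by rewrite -(rowt j) rowE addrC subrK.
Qed.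
End RegularSquares.

(** * Symmetric designs *)

Lemma sum_inclusion_exclusion (n : nat) (a b : 'I_n -> bool) :
  \sum_k (a k (+) b k) + 2 * \sum_k (a k && b k) = \sum_k a k + \sum_k b k.
Proof.
rewrite big_distrr -!big_split; apply: eq_bigr => k _.
by case: (a k) (b k) => [] [].
Qed.

(** With rows and columns of constant weight k, two rows at distance d share
    exactly (2k-d)/2 ones. *)
Lemma square_equidistant_sbibd (n d : nat) (W : 'I_n -> 'I_n -> bool) :
  0 < d -> 2 * d < n -> equidistant_rows d W ->
  exists s k : nat, [/\ s ^ 2 = 2 * d + (n - 2 * d) * n, 2 * k + s = n &
    sbibd_exists n k ((2 * k - d) %/ 2)].
Proof.
move=> d_gt0 dn distW.
(* Complementing the columns with a majority of ones makes all the column sums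
   of signs nonnegative. *)
pose V i j := W i j (+) (n < 2 * \sum_i W i j).
have distV : equidistant_rows d V.
  move=> i j /distW <-; apply: eq_bigr => k _.
  by rewrite addbACA addbb addbF.
have col_le j : 2 * \sum_i V i j <= n.
  rewrite /V; case: (ltnP n) => [lt_n|le_n]; last first.
    by under eq_bigr => i _ do rewrite addbF.
  under eq_bigr => i _ do rewrite addbT.
  by have := sum_negb n (W^~ j); lia.
have [s sE [colV rowV]] := square_equidistant_regular _ _ _ d_gt0 dn distV col_le.
pose k := (n - s) %/ 2.
have colk j : \sum_i V i j = k by have := colV j; rewrite /k; lia.
have rowk j : \sum_i V j i = k by have := rowV j; rewrite /k; lia.
exists s, k; split=> //.
  by have := rowV (Ordinal (leq_ltn_trans (leq0n _) dn)); rewrite rowk.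
exists (fun b => [set p | V p b]); split=> [b|p|p q /eqP pq].
- by rewrite card_sum_bool.
- rewrite card_sum_bool -[RHS](rowk p).
  by apply: eq_bigr => b _; rewrite inE.
rewrite card_sum_bool; under eq_bigr => b _ do rewrite !inE.
by have := sum_inclusion_exclusion n (V p) (V q); rewrite distV// !rowk; lia.
Qed.

Lemma sbibd_equidistant_code (v k lambda : nat) :
  lambda < k -> sbibd_exists v k lambda -> code_exists v (2 * (k - lambda)) v.
Proof.
move=> lt_lk [B [_ repB pairB]]; apply/code_exists_rows; first by lia.
exists (fun p b => p \in B b) => p q /eqP /pairB pq.
have := sum_inclusion_exclusion v (fun b => p \in B b) (fun b => q \in B b).
move: pq (repB p) (repB q); rewrite !card_sum_bool => -> -> -> e.
by apply: (@addIn (2 * lambda)); rewrite e; lia.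
Qed.

(** * Parameters of the designs *)

Lemma leq_sqr (u : nat) : u <= u ^ 2.
Proof. by case: u => // u; rewrite -mulnn leq_pmulr. Qed.

(** The sum of signs in a column is s = 2u+1 with s^2 = 2n-1, and the weight of
    the design is (n-s)/2 = u^2. *)
Lemma code_sbibd_mod4_1 (n : nat) (hn : 3 <= n) : n = 1 %[mod 4] ->
        (code_exists n ((n - 1) %/ 2) n <->
         exists u : nat, [/\ 0 < u, n = 2 * u ^ 2 + 2 * u + 1
           & sbibd_exists (2 * u ^ 2 + 2 * u + 1) (u ^ 2) ((u ^ 2 - u) %/ 2)]).
Proof.
move=> n_mod; split=> [|[u [u_gt0 nE]]].
  move=> /code_exists_rows [|W distW]; first by lia.
  have [||s [k [sE kE designk]]] :=
    square_equidistant_sbibd _ _ _ _ _ distW; try lia.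
  have {}sE : s ^ 2 = 2 * n - 1.
    by rewrite sE (_ : n - 2 * _ = 1); lia.
  pose u := s %/ 2.
  have [su|su] : s = 2 * u \/ s = 2 * u + 1 by rewrite /u; lia.
    by move: sE; rewrite su expnMn; lia.
  have nE : n = 2 * u ^ 2 + 2 * u + 1 by move: sE; rewrite su sqrnD expnMn; lia.
  have u_gt0 : 0 < u by case: (posnP u) nE => // ->; lia.
  exists u; split=> //; rewrite -nE.
  have ku : k = u ^ 2 by lia.
  by move: designk; rewrite ku; congr sbibd_exists; lia.
rewrite -nE => /sbibd_equidistant_code.
have le_u := leq_sqr u.
have -> : 2 * (u ^ 2 - (u ^ 2 - u) %/ 2) = (n - 1) %/ 2 by lia.
by apply; lia.
Qed.

(** The sum of signs in a column is s = 2t with s^2 = 3n-2, so that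
    3n = 4t^2+2, and 3 does not divide t.  As t is nonnegative, it is 3u+1 or 3u-1
    for some u, and u > 0 because n > 2. *)
Lemma code_sbibd_mod4_2 (n : nat) (hn : 3 <= n) : n = 2 %[mod 4] ->
        (code_exists n ((n - 2) %/ 2) n <->
         exists u : nat, 0 < u /\
           ((n = 12 * u ^ 2 + 8 * u + 2 /\
            sbibd_exists (12 * u ^ 2 + 8 * u + 2) (6 * u ^ 2 + u)
              (3 * u ^ 2 - u)) \/
           (n = 12 * u ^ 2 + 2 - 8 * u /\
            sbibd_exists (12 * u ^ 2 + 2 - 8 * u) (6 * u ^ 2 + 2 - 7 * u)
              (3 * u ^ 2 + 2 - 5 * u)))).
Proof.
move=> n_mod; split=> [|[u [u_gt0 [[nE]|[nE]]]]].
- move=> /code_exists_rows [|W distW]; first by lia.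
  have [||s [k [sE kE designk]]] :=
    square_equidistant_sbibd _ _ _ _ _ distW; try lia.
  have {}sE : s ^ 2 = 3 * n - 2.
    by rewrite sE (_ : n - 2 * _ = 2); lia.
  have [t st] : exists t, s = 2 * t by exists (s %/ 2); lia.
  have tE : 4 * t ^ 2 + 2 = 3 * n by move: sE; rewrite st expnMn; lia.
  (* This u is the integer nearest to t/3 when 3 does not divide t. *)
  pose u := (t + 1) %/ 3; exists u.
  have [tu|[tu|tu]] : t = 3 * u + 1 \/ (t + 1 = 3 * u \/ t = 3 * (t %/ 3)).
    by rewrite /u; lia.
  + have nE : n = 12 * u ^ 2 + 8 * u + 2 by move: tE; rewrite tu sqrnD expnMn; lia.
    have u_gt0 : 0 < u by case: (posnP u) nE => // ->; lia.
    split=> //; left; split=> //; rewrite -nE.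
    have ku : k = 6 * u ^ 2 + u by lia.
    by move: designk; rewrite ku; congr sbibd_exists; lia.
  + have u_gt0 : 0 < u by lia.
    have nE : n = 12 * u ^ 2 + 2 - 8 * u.
      have : (t + 1) ^ 2 = (3 * u) ^ 2 by rewrite tu.
      by rewrite sqrnD expnMn; lia.
    split=> //; right; split=> //; rewrite -nE.
    have ku : k = 6 * u ^ 2 + 2 - 7 * u by lia.
    by move: designk; rewrite ku; congr sbibd_exists; lia.
  by move: tE; rewrite tu expnMn; lia.
- rewrite -nE => /sbibd_equidistant_code.
  have le_u := leq_sqr u.
  have -> : 2 * (6 * u ^ 2 + u - (3 * u ^ 2 - u)) = (n - 2) %/ 2 by lia.
  by apply; lia.
- rewrite -nE => /sbibd_equidistant_code.
  (* (u-1)(u-2) >= 0 ensures that no subtraction is truncated. *)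
  have le_u : 3 * u <= u ^ 2 + 2.
    by move: u u_gt0 {nE} => [|[|u]] // _; rewrite -(addn2 u) sqrnD; lia.
  have -> : 2 * (6 * u ^ 2 + 2 - 7 * u - (3 * u ^ 2 + 2 - 5 * u))
          = (n - 2) %/ 2 by lia.
  by apply; lia.
Qed.

Theorem theorem1p3 (n : nat) (hn : 3 <= n) :
  [/\ n = 3 %[mod 4] ->
        (code_exists n (n.+1 %/ 2) n.+1 <-> hadamard_exists n.+1),
      n = 0 %[mod 4] ->
        (code_exists n (n %/ 2) n <-> hadamard_exists n),
      n = 1 %[mod 4] ->
        (code_exists n ((n - 1) %/ 2) n <->
         exists u : nat, [/\ 0 < u, n = 2 * u ^ 2 + 2 * u + 1
           & sbibd_exists (2 * u ^ 2 + 2 * u + 1) (u ^ 2) ((u ^ 2 - u) %/ 2)])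
    & n = 2 %[mod 4] ->
        (code_exists n ((n - 2) %/ 2) n <->
         exists u : nat, 0 < u /\
           ((* truncated subtraction: negative terms are taken last *)
            (n = 12 * u ^ 2 + 8 * u + 2 /\
             sbibd_exists (12 * u ^ 2 + 8 * u + 2) (6 * u ^ 2 + u)
               (3 * u ^ 2 - u)) \/
            (n = 12 * u ^ 2 + 2 - 8 * u /\
             sbibd_exists (12 * u ^ 2 + 2 - 8 * u) (6 * u ^ 2 + 2 - 7 * u)
               (3 * u ^ 2 + 2 - 5 * u))))].
Proof.
split=> n_mod.
- by apply: code_hadamard_punctured; lia.
- by apply: code_hadamard; lia.
- exact: code_sbibd_mod4_1.
- exact: code_sbibd_mod4_2.
Qed.
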